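(* Let $A^{*}_s=\big((A^{*}_s)^{kl}_{\alpha\beta}\big)$ and $B^{*}_s=\big((B^{*}_s)^{kl}_{\alpha\beta}\big)$ be two real fourth-order tensors, with all indices in $\{1,\dots,d\}$, each possessing the full symmetry $$C^{kl}_{\alpha\beta}=C^{\alpha l}_{k\beta}=C^{k\beta}_{\alpha l}=C^{lk}_{\beta\alpha}\qquad\text{for all }\alpha,\beta,k,l\qquad(C=A^{*}_s,\,B^{*}_s).$$ Then $A^{*}_s$ and $B^{*}_s$ satisfy the same propagation relation (see context), i.e. $$M(\hat\eta,A^{*}_s)\,\phi^0_{s,m,\hat\eta}=M(\hat\eta,B^{*}_s)\,\phi^0_{s,m,\hat\eta}\qquad\text{for all }\hat\eta\in\mathbb{S}^{d-1}\text{ and all }m=1,\dots,d-1,$$ if and only if there exists $c\in\mathbb{R}$ such that $$B^{*}_s-A^{*}_s=c\,(I\otimes I).$$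
   Context: Summation over repeated indices is used, and $d\ge2$. $I$ is the $d\times d$ identity matrix and $I\otimes I$ is the fourth-order tensor $(I\otimes I)^{jl}_{\alpha\beta}=\delta_{\alpha j}\delta_{\beta l}$. For a fourth-order tensor $C$ and $\hat\eta\in\mathbb{S}^{d-1}\subset\mathbb{R}^d$, $M(\hat\eta,C)$ is the $d\times d$ matrix with entries $M(\hat\eta,C)_{jl}=C^{jl}_{\alpha\beta}\hat\eta_\alpha\hat\eta_\beta$. For each $\hat\eta\in\mathbb{S}^{d-1}$, $\{\phi^0_{s,1,\hat\eta},\dots,\phi^0_{s,d-1,\hat\eta}\}$ is an orthonormal basis of the subspace of $\mathbb{R}^d$ orthogonal to $\hat\eta$ (in the application these are the values at zero momentum of the Bloch eigenvectors, in direction $\hat\eta$, of the incompressible elasticity operator $-\nabla\cdot(\mu E(u))+\nabla p$, $\nabla\cdot u=0$, with $E(u)=\frac12(\nabla u+\nabla^t u)$; the homogenized tensors of that system possess the full symmetry above). The propagation relation for a tensor $C$ is $$\tfrac12\lambda''_{s,m,\hat\eta}(0)\,\phi^0_{s,m,\hat\eta}=\tfrac12 q''_{0,s,m,\hat\eta}(0)\,\hat\eta+M(\hat\eta,C)\,\phi^0_{s,m,\hat\eta},\qquad m=1,\dots,d-1,\ \hat\eta\in\mathbb{S}^{d-1},$$ where $\lambda''_{s,m,\hat\eta}(0)$ and $q''_{0,s,m,\hat\eta}(0)$ are scalars given by the Bloch spectral data. Two tensors satisfy the same propagation relation when it holds for both with the same spectral data, i.e. when they give the same vectors $M(\hat\eta,\cdot)\phi^0_{s,m,\hat\eta}$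 for all $m$ and $\hat\eta$. *)

(* Defs.v *)
From mathcomp Require Import all_boot all_order all_algebra.
From mathcomp Require Import reals.

Set Implicit Arguments.
Unset Strict Implicit.
Unset Printing Implicit Defensive.

Import Order.TTheory GRing.Theory Num.Theory.
Local Open Scope ring_scope.

(* C (k, l, alpha, beta) is the entry with superscripts k, l and subscripts
   alpha, beta.  The codomain R^o (R as a module over itself) makes the type
   an R-module, so that tensors can be subtracted and scaled. *)
Definition tensor4 (R : realType) (d : nat) : Type :=
  {ffun 'I_d * 'I_d * 'I_d * 'I_d -> R^o}.

Definition entry (R : realType) (d : nat) (C : tensor4 R d)
  (k l alpha beta : 'I_d) : R :=
  (C : {ffun _ -> R^o}) (k, l, alpha, beta).

Definition fully_symmetric (R : realType) (d : nat) (C : tensor4 R d) : Prop :=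
  forall alpha beta k l : 'I_d,
    [/\ entry C k l alpha beta = entry C alpha l k beta,
        entry C k l alpha beta = entry C k beta alpha l
      & entry C k l alpha beta = entry C l k beta alpha].

Definition tensorII (R : realType) (d : nat) : tensor4 R d :=
  [ffun i : 'I_d * 'I_d * 'I_d * 'I_d =>
     let: (j, l, alpha, beta) := i in
     (alpha == j)%:R * (beta == l)%:R : R^o].

Definition Mmx (R : realType) (d : nat) (eta : 'cV[R]_d) (C : tensor4 R d) :
  'M[R]_d :=
  \matrix_(j, l) \sum_alpha \sum_beta
     entry C j l alpha beta * eta alpha 0 * eta beta 0.

Definition dot (R : realType) (d : nat) (u v : 'cV[R]_d) : R :=
  \sum_i u i 0 * v i 0.

(* The Euclidean sphere: the norm of MathComp-Analysis on matrices is the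
   sup norm. *)
Definition unit_sphere (R : realType) (d : nat) (eta : 'cV[R]_d) : Prop :=
  dot eta eta = 1.

(* Linear independence is implied by orthonormality. *)
Definition orthonormal_basis_of_orthogonal (R : realType) (d : nat)
  (eta : 'cV[R]_d) (e : 'I_d.-1 -> 'cV[R]_d) : Prop :=
  [/\ forall m, dot eta (e m) = 0,
      forall m n, dot (e m) (e n) = (m == n)%:R
    & forall v, dot eta v = 0 ->
        exists a : 'I_d.-1 -> R, v = \sum_m a m *: e m].

(* The propagation relation expresses M(eta, C) phi_m in terms of spectral
   data that do not depend on C; two tensors satisfy the same relation when
   they give the same vectors M(eta, C) phi_m. *)
Definition same_propagation_relation (R : realType) (d : nat)
  (phi : 'cV[R]_d -> 'I_d.-1 -> 'cV[R]_d) (A B : tensor4 R d) : Prop :=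
  forall eta : 'cV[R]_d, unit_sphere eta ->
  forall m : 'I_d.-1, Mmx eta A *m phi eta m = Mmx eta B *m phi eta m.

(* Main.v *)
Require Import Defs.
From mathcomp Require Import all_boot all_order all_algebra.
From mathcomp Require Import reals.
From mathcomp Require Import ring lra.

Set Implicit Arguments.
Unset Strict Implicit.
Unset Printing Implicit Defensive.

Import Order.TTheory GRing.Theory Num.Theory.
Local Open Scope ring_scope.

(** The propagation relation is linear in the tensor, so the question is which
    fully symmetric [D] (here [D = B - A]) satisfy
    [Mmx eta D *m phi_m = 0] for every unit [eta] and every [m].  The vectors
    [phi_m] span the orthogonal complement of [eta] and [Mmx eta D] is
    quadratic in [eta]; hence this says that [Mmx eta D *m v = 0] for all
    orthogonal [eta] and [v], with no normalisation
    ([same_propagation_annihilates]).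

    Full symmetry says that [T a b l m := entry D a l b m] is symmetric in
    [a, b], symmetric in [l, m], and unchanged when the two pairs are
    exchanged: [D] is a symmetric bilinear form on symmetric matrices.
    Annihilation says that this form vanishes on the pairs made of a product
    [u eta] and a product [v eta] with [v] orthogonal to [eta].  Three choices
    of [(eta, v)] are enough to determine the form ([annihilates_rigid]):
    - [(e_i, e_l)] with [i != l] gives [T j i l i = 0] for every [j];
    - [(e_i + e_k, e_l)], with [i], [k], [l] distinct, then makes [T j i l k]
      change sign when [i] and [k] are exchanged, so that the three splittings
      of [j, i, l, k] into two pairs have pairwise opposite coefficients, all
      zero; with the symmetries, [T a b l m] is zero unless [a = b] and
      [l = m];
    - [(e_i + e_k, e_i - e_k)], for which [v eta = e_i e_i - e_k e_k],
      identifies all the [T i i k k] with a single constant [c].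
    What is left is [c] times the square of the trace, that is
    [c *: tensorII].  Conversely [Mmx eta tensorII] is the rank-one matrix
    [eta *m eta^T], which annihilates every vector orthogonal to [eta]. *)

(** * Linearity in the tensor and scaling in the direction *)

Lemma entryB (R : realType) (d : nat) (A B : tensor4 R d) (k l a b : 'I_d) :
  entry (B - A) k l a b = entry B k l a b - entry A k l a b.
Proof. by rewrite /entry !ffunE. Qed.

Lemma fully_symmetricB (R : realType) (d : nat) (A B : tensor4 R d) :
  fully_symmetric A -> fully_symmetric B -> fully_symmetric (B - A).
Proof.
move=> sA sB a b k l; rewrite !entryB.
by have [<- <- <-] := sA a b k l; have [<- <- <-] := sB a b k l.
Qed.

Lemma MmxB (R : realType) (d : nat) (eta : 'cV[R]_d) (A B : tensor4 R d) :
  Mmx eta (B - A) = Mmx eta B - Mmx eta A.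
Proof.
apply/matrixP => j l; rewrite !mxE -sumrB; apply: eq_bigr => a _.
by rewrite -sumrB; apply: eq_bigr => b _; rewrite entryB !mulrBl.
Qed.

Lemma MmxZ (R : realType) (d : nat) (s : R) (eta : 'cV[R]_d) (C : tensor4 R d) :
  Mmx (s *: eta) C = s ^+ 2 *: Mmx eta C.
Proof.
apply/matrixP => j l; rewrite !mxE mulr_sumr; apply: eq_bigr => a _.
by rewrite mulr_sumr; apply: eq_bigr => b _; rewrite !mxE; ring.
Qed.

Lemma Mmx_tensorII (R : realType) (d : nat) (c : R) (eta : 'cV[R]_d) :
  Mmx eta (c *: tensorII R d) = c *: (eta *m eta^T).
Proof.
apply/matrixP => j l; rewrite !mxE big_ord1 !mxE.
rewrite (bigD1 j) //= [X in _ + X]big1 ?addr0 => [|a /negPf aj].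
  rewrite (bigD1 l) //= [X in _ + X]big1 ?addr0 => [|b /negPf bl].
    by rewrite /entry !ffunE !eqxx /GRing.scale /=; ring.
  by rewrite /entry !ffunE bl mulr0 /GRing.scale /= mulr0 !mul0r.
rewrite big1 // => b _.
by rewrite /entry !ffunE aj mul0r /GRing.scale /= mulr0 !mul0r.
Qed.

(** * The Euclidean product *)

Lemma dotE (R : realType) (d : nat) (u v : 'cV[R]_d) :
  dot u v = (u^T *m v) 0 0.
Proof. by rewrite mxE; apply: eq_bigr => i _; rewrite mxE. Qed.

Lemma dotZ (R : realType) (d : nat) (s t : R) (u v : 'cV[R]_d) :
  dot (s *: u) (t *: v) = s * t * dot u v.
Proof. by rewrite /dot mulr_sumr; apply: eq_bigr => i _; rewrite !mxE; ring. Qed.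

Lemma dot_eq0 (R : realType) (d : nat) (u : 'cV[R]_d) : dot u u = 0 -> u = 0.
Proof.
move/psumr_eq0P => u0; apply/matrixP => i j; rewrite ord1 mxE.
have /eqP : u i 0 * u i 0 = 0 by apply: u0 => // k _; rewrite -expr2 sqr_ge0.
by rewrite mulf_eq0 orbb => /eqP.
Qed.

Lemma dot_delta (R : realType) (d : nat) (i j : 'I_d) :
  dot (delta_mx i 0 : 'cV[R]_d) (delta_mx j 0) = (i == j)%:R.
Proof.
rewrite /dot (bigD1 i) //= big1 ?addr0 => [|k /negPf ki].
  by rewrite !mxE !eqxx mul1r andbT.
by rewrite !mxE ki mul0r.
Qed.

Lemma dotDl (R : realType) (d : nat) (u v w : 'cV[R]_d) :
  dot (u + v) w = dot u w + dot v w.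
Proof. by rewrite !dotE linearD mulmxDl mxE. Qed.

Lemma dotBr (R : realType) (d : nat) (u v w : 'cV[R]_d) :
  dot w (u - v) = dot w u - dot w v.
Proof. by rewrite !dotE mulmxBr !mxE. Qed.

(** * Reduction to all pairs of orthogonal vectors *)

Definition annihilates (R : realType) (d : nat) (D : tensor4 R d) : Prop :=
  forall eta v : 'cV[R]_d, dot eta v = 0 -> Mmx eta D *m v = 0.

(** An orthonormal basis of the complement of [eta / |eta|] spans the
    complement of [eta], and rescaling [eta] only rescales [Mmx eta _]. *)
Lemma same_propagation_annihilates (R : realType) (d : nat)
  (phi : 'cV[R]_d -> 'I_d.-1 -> 'cV[R]_d)
  (hphi : forall eta : 'cV[R]_d, unit_sphere eta ->
     orthonormal_basis_of_orthogonal eta (phi eta))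
  (A B : tensor4 R d) :
  same_propagation_relation phi A B <-> annihilates (B - A).
Proof.
split=> [same eta v eta_v | ann eta unit_eta m]; last first.
  have [perp _ _] := hphi eta unit_eta.
  by apply/eqP; rewrite eq_sym -subr_eq0 -mulmxBl -MmxB ann.
have [/dot_eq0 -> | eta_neq0] := eqVneq (dot eta eta) 0.
  by rewrite -(scale0r (0 : 'cV[R]_d)) MmxZ expr0n !scale0r mul0mx.
have eta_ge0 : 0 <= dot eta eta.
  by apply: sumr_ge0 => i _; rewrite -expr2 sqr_ge0.
pose s := Num.sqrt (dot eta eta).
have s2 : s ^+ 2 = dot eta eta by rewrite sqr_sqrtr.
have s_neq0 : s != 0 by rewrite -sqrf_eq0 s2.
pose e := s^-1 *: eta.
have unit_e : unit_sphere e.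
  by rewrite /unit_sphere dotZ -s2 expr2; field.
have [_ _ span] := hphi e unit_e.
have e_v : dot e v = 0 by rewrite -[v]scale1r dotZ eta_v mulr0.
have [a ->] := span v e_v.
rewrite mulmx_sumr big1 // => m _.
have -> : eta = s *: e by rewrite scalerA divff // scale1r.
by rewrite -scalemxAr MmxZ -scalemxAl MmxB mulmxBl same // subrr !scaler0.
Qed.

(** * Polarisation of the quadratic map [eta |-> Mmx eta C] *)

(** The cubic form [v, eta, zeta |-> (M v)_j], with the two occurrences of
    [eta] in [M] polarised so that it can be expanded slot by slot. *)
Definition contract (R : realType) (d : nat) (C : tensor4 R d) (j : 'I_d)
  (v eta zeta : 'cV[R]_d) : R :=
  \sum_l \sum_a \sum_b entry C j l a b * eta a 0 * zeta b 0 * v l 0.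

Lemma Mmx_mulE (R : realType) (d : nat) (C : tensor4 R d) (j : 'I_d)
  (v eta : 'cV[R]_d) : (Mmx eta C *m v) j 0 = contract C j v eta eta.
Proof.
rewrite mxE; apply: eq_bigr => l _; rewrite mxE mulr_suml.
by apply: eq_bigr => a _; rewrite mulr_suml.
Qed.

Lemma contractBv (R : realType) (d : nat) (C : tensor4 R d) (j : 'I_d)
  (v w eta zeta : 'cV[R]_d) :
  contract C j (v - w) eta zeta
  = contract C j v eta zeta - contract C j w eta zeta.
Proof.
rewrite /contract -sumrB; apply: eq_bigr => l _; rewrite -sumrB.
apply: eq_bigr => a _; rewrite -sumrB; apply: eq_bigr => b _.
by rewrite !mxE; ring.
Qed.

Lemma contractDl (R : realType) (d : nat) (C : tensor4 R d) (j : 'I_d)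
  (v eta eta' zeta : 'cV[R]_d) :
  contract C j v (eta + eta') zeta
  = contract C j v eta zeta + contract C j v eta' zeta.
Proof.
rewrite /contract -big_split; apply: eq_bigr => l _; rewrite -big_split.
apply: eq_bigr => a _; rewrite -big_split; apply: eq_bigr => b _.
by rewrite /= !mxE; ring.
Qed.

Lemma contractDr (R : realType) (d : nat) (C : tensor4 R d) (j : 'I_d)
  (v eta zeta zeta' : 'cV[R]_d) :
  contract C j v eta (zeta + zeta')
  = contract C j v eta zeta + contract C j v eta zeta'.
Proof.
rewrite /contract -big_split; apply: eq_bigr => l _; rewrite -big_split.
apply: eq_bigr => a _; rewrite -big_split; apply: eq_bigr => b _.
by rewrite /= !mxE; ring.
Qed.

Lemma contract_delta (R : realType) (d : nat) (C : tensor4 R d)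
  (j l a b : 'I_d) :
  contract C j (delta_mx l 0) (delta_mx a 0) (delta_mx b 0) = entry C j l a b.
Proof.
rewrite /contract (bigD1 l) //= [X in _ + X]big1 ?addr0 => [|l' /negPf l'l].
  rewrite (bigD1 a) //= [X in _ + X]big1 ?addr0 => [|a' /negPf a'a].
    rewrite (bigD1 b) //= [X in _ + X]big1 ?addr0 => [|b' /negPf b'b].
      by rewrite !mxE !eqxx !mulr1.
    by rewrite !mxE b'b mulr0 mul0r.
  by rewrite big1 // => b' _; rewrite !mxE a'a mulr0 !mul0r.
by rewrite big1 // => a' _; rewrite big1 // => b' _; rewrite !mxE l'l mulr0.
Qed.

Definition contractE := (contractBv, contractDl, contractDr, contract_delta).

(** * Rigidity of the annihilated tensors *)

(** The combinatorial core.  [T a b l m] is the coefficient of a form on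
    symmetric matrices at [e_a e_b] and [e_l e_m]; the last three hypotheses
    are the tests of the form against [(e_i, e_l)],
    [(e_i + e_k, e_i - e_k)] and [(e_i + e_k, e_l)]. *)
Lemma form_rigid (R : realFieldType) (d : nat)
  (T : 'I_d -> 'I_d -> 'I_d -> 'I_d -> R)
  (symL : forall a b l m, T a b l m = T b a l m)
  (symR : forall a b l m, T a b l m = T a b m l)
  (symP : forall a b l m, T a b l m = T l m a b)
  (testE : forall j i l, i != l -> T j i l i = 0)
  (testB : forall j i k, i != k ->
     T j i i i + T j k i i = T j i k k + T j k k k)
  (testD : forall j i k l, i != k -> i != l -> k != l ->
     T j i l k + T j k l i = 0)
  (i0 a b l m : 'I_d) :
  T a b l m = T i0 i0 i0 i0 * ((a == b)%:R * (l == m)%:R).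
Proof.
have off a' b' l' m' : l' != m' -> T a' b' l' m' = 0.
  move=> lm; have [-> | bl] := eqVneq b' l'.
    by rewrite symR testE // eq_sym.
  have [-> | bm] := eqVneq b' m'; first by rewrite testE // eq_sym.
  have ml : m' != l' by rewrite eq_sym.
  have mb : m' != b' by rewrite eq_sym.
  have lb : l' != b' by rewrite eq_sym.
  (* Each [testD] moves an index across the two pairs, with [a'] arbitrary:
     the three sums of two among the three splittings of [a', b', l', m'] are
     zero. *)
  have e1 := testD a' _ _ _ bl bm lm.
  have e2 := testD a' _ _ _ bm bl ml.
  have e3 := testD a' _ _ _ lm lb mb.
  rewrite (symR a' b' m') (symR a' l') in e1; rewrite (symR a' m') in e2.
  by lra.
have diag_eq i k : T i i k k = T i i i i.
  have [-> //|ik] := eqVneq i k.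
  have := testB i i k ik; rewrite (symP i k i i) (symP i k k k).
  by rewrite (off i i i k ik) (off k k i k ik) !addr0.
have diag i k : T i i k k = T i0 i0 i0 i0.
  by rewrite diag_eq -(diag_eq i i0) symP diag_eq.
have [<- | lm] := eqVneq l m; last by rewrite off // !mulr0.
have [<- | ab] := eqVneq a b; first by rewrite !mulr1 diag.
by rewrite symP off // mul0r mulr0.
Qed.

(** The tests of [form_rigid] are values of [contract] at sums of basis
    vectors, freed of superfluous terms: in [(e_i + e_k) (e_i - e_k)] the
    products [e_i e_k] cancel by [symR], and for [(e_i + e_k, e_l)] the values
    at [(e_i, e_l)] and [(e_k, e_l)] are zero. *)
Lemma annihilates_rigid (R : realType) (d : nat) (D : tensor4 R d)
  (sD : fully_symmetric D) (ann : annihilates D) (i0 : 'I_d) :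
  D = entry D i0 i0 i0 i0 *: tensorII R d.
Proof.
have test j (eta v : 'cV[R]_d) : dot eta v = 0 -> contract D j v eta eta = 0.
  by move=> eta_v; rewrite -Mmx_mulE ann // mxE.
have symL a b l m : entry D a l b m = entry D b l a m.
  by have [] := sD b m a l.
have symR a b l m : entry D a l b m = entry D a m b l.
  by have [] := sD b m a l.
have symP a b l m : entry D a l b m = entry D l a m b.
  by have [] := sD b m a l.
apply/ffunP => -[[[k l] a] b]; rewrite !ffunE (eq_sym b) -[LHS]/(entry D k l a b).
rewrite (form_rigid (T := fun a b l m => entry D a l b m) symL symR symP
  _ _ _ i0) ?(eq_sym k a) //.
- move=> j i l' il.
  have := test j (delta_mx i 0) (delta_mx l' 0).
  by rewrite contractE dot_delta (negPf il) => ->.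
- move=> j i k' ik.
  have := test j (delta_mx i 0 + delta_mx k' 0) (delta_mx i 0 - delta_mx k' 0).
  rewrite !contractE dotDl !dotBr !dot_delta !eqxx (eq_sym k') (negPf ik).
  rewrite (symR j i k' i) (symR j k' k' i) subr0 sub0r subrr.
  by move=> /(_ erefl); lra.
move=> j i k' l' ik il kl.
have := test j (delta_mx i 0 + delta_mx k' 0) (delta_mx l' 0).
rewrite !contractE dotDl !dot_delta (negPf il) (negPf kl) addr0.
have := test j (delta_mx i 0) (delta_mx l' 0).
have := test j (delta_mx k' 0) (delta_mx l' 0).
rewrite !contractE !dot_delta (negPf il) (negPf kl).
by move=> /(_ erefl) -> /(_ erefl) -> /(_ erefl); lra.
Qed.

(** [Mmx eta (tensorII R d)] maps every vector to a multiple of [eta], with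
    factor its dot product with [eta]. *)
Lemma annihilates_tensorII (R : realType) (d : nat) (c : R) :
  annihilates (c *: tensorII R d).
Proof.
move=> eta v eta_v; rewrite Mmx_tensorII -scalemxAl -mulmxA.
by rewrite [_^T *m _]mx11_scalar -dotE eta_v raddf0 mulmx0 scaler0.
Qed.

Theorem proposition4p2 (R : realType) (d : nat) (hd : (2 <= d)%N)
  (phi : 'cV[R]_d -> 'I_d.-1 -> 'cV[R]_d)
  (hphi : forall eta : 'cV[R]_d, unit_sphere eta ->
     orthonormal_basis_of_orthogonal eta (phi eta))
  (A B : tensor4 R d)
  (hA : fully_symmetric A) (hB : fully_symmetric B) :
  same_propagation_relation phi A B <->
  exists c : R, B - A = c *: tensorII R d.
Proof.
rewrite (same_propagation_annihilates hphi); split=> [ann | [c ->]]; last first.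
  exact: annihilates_tensorII.
pose i0 := Ordinal (ltnW hd).
exists (entry (B - A) i0 i0 i0 i0).
exact: annihilates_rigid (fully_symmetricB hA hB) ann i0.
Qed.
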